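(* Let $k\ge1$ be an integer, let $l_i\in\mathbb{C}$, $i=1,\ldots,2k$, be finite-element parameters and let $\hat h_i,h_i\in\mathbb{C}\cup\{\infty\}$, $i=1,\ldots,k$, be finite-difference parameters. If $$f_k(s)\equiv \mathrm{tanh}_{\rm FE}(s/2)$$ identically in $s$, then the finite-element and finite-difference approximate Dirichlet-to-Neumann maps coincide: $$\tilde F(s)\equiv\hat F(s).$$
   Context: The maps arise from discretizing the first-order system $u_x=sv$, $v_x=su$ on $[0,1]$, and are given by the following formulas. The symbol $\equiv$ denotes equality as (matrix-valued) rational functions of $s$, wherever they are defined. Let $Z=\frac{1}{\sqrt2}\begin{bmatrix}1&-1\\1&1\end{bmatrix}$, and let $Z^*$ be its transpose. Finite-element side (linear elements with midpoint integration, $n=2k$ elements with lengths $l_i$): put $$t(s)=\prod_{i=1}^{2k}\left(1-\frac{l_i s}{2}\right),\qquad \exp_{\rm FE}(s)=\frac{t(-s)}{t(s)},$$ $$\sinh_{\rm FE}(s)=\frac{\exp_{\rm FE}(s)-\exp_{\rm FE}(-s)}{2},\qquad \cosh_{\rm FE}(s)=\frac{\exp_{\rm FE}(s)+\exp_{\rm FE}(-s)}{2},$$ $$\mathrm{tanh}_{\rm FE}(s/2)=\frac{t(-s)-t(s)}{t(-s)+t(s)} .$$ Here $\mathrm{tanh}_{\rm FE}(s/2)$ is the name of a single rational function of $s$. The finite-element Dirichlet-to-Neumann map is $$\tilde F(s)=\frac{1}{\sinh_{\rm FE}(s)}\begin{bmatrix}\cosh_{\rm FE}(s)&-1\\-1&\cosh_{\rm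 FE}(s)\end{bmatrix}.$$ Finite-difference side (staggered grid with steps $\hat h_i,h_i$): put $$f_k(s)=\cfrac{1}{\hat h_1 s+\cfrac{1}{h_1 s+\cfrac{1}{\hat h_2 s+\cdots+\cfrac{1}{h_{k-1}s+\cfrac{1}{\hat h_k s+\cfrac{1}{h_k s}}}}}},$$ where infinite parameter values are interpreted with the usual convention $1/\infty=0$. The finite-difference Dirichlet-to-Neumann map is $$\hat F(s)=Z\begin{bmatrix}f_k(s)&0\\0&1/f_k(s)\end{bmatrix}Z^*.$$ *)

(* Defs.v *)
From HB Require Import structures.
From mathcomp Require Import all_boot all_order all_algebra.
From mathcomp Require Import reals complex.
Set Implicit Arguments.
Unset Strict Implicit.
Unset Printing Implicit Defensive.
Import GRing.Theory Num.Theory.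
Local Open Scope ring_scope.

(* The field C(s) of rational functions with complex coefficients. *)
Notation ratfun R := {fraction {poly R[i]}}.

Definition ratC (R : realType) (c : R[i]) : ratfun R := tofrac c%:P.

Definition ratS (R : realType) : ratfun R := tofrac ('X : {poly R[i]}).

Definition mx22 (K : pzRingType) (a b c d : K) : 'M[K]_2 :=
  \matrix_(i < 2, j < 2) nth 0 (nth [::] [:: [:: a; b]; [:: c; d]] i) j.

(* Finite-element side. The functions of the variable [s] are written as
   functions of an arbitrary [x] in C(s), so that replacing [s] by [- s] is
   ordinary application. No division by zero occurs in [expFE], [sinhFE],
   [coshFE], [tanhFE_half] at [x = ratS R] or [x = - ratS R], because the
   polynomial [t] has constant coefficient 1. *)

Definition tFE (R : realType) (n : nat) (l : 'I_n -> R[i]) (x : ratfun R) :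
    ratfun R :=
  \prod_(i < n) (1 - ratC (l i) * x / 2%:R).

Definition expFE (R : realType) (n : nat) (l : 'I_n -> R[i]) (x : ratfun R) :
    ratfun R :=
  tFE l (- x) / tFE l x.

Definition sinhFE (R : realType) (n : nat) (l : 'I_n -> R[i]) (x : ratfun R) :
    ratfun R :=
  (expFE l x - expFE l (- x)) / 2%:R.

Definition coshFE (R : realType) (n : nat) (l : 'I_n -> R[i]) (x : ratfun R) :
    ratfun R :=
  (expFE l x + expFE l (- x)) / 2%:R.

(* [tanhFE_half l s] is the rational function denoted tanh_FE(s/2): its
   argument is [s], not [s/2]. *)
Definition tanhFE_half (R : realType) (n : nat) (l : 'I_n -> R[i])
    (x : ratfun R) : ratfun R :=
  (tFE l (- x) - tFE l x) / (tFE l (- x) + tFE l x).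

(* Arithmetic with a single point at infinity, [None]. An infinite summand
   absorbs the other one, also when the latter is infinite, so that
   [1 / (oo + y) = 0] for every [y]. *)

Definition ext_add (K : fieldType) (x y : option K) : option K :=
  if x is Some a then (if y is Some b then Some (a + b) else None) else None.

Definition ext_inv (K : fieldType) (x : option K) : option K :=
  if x is Some a then (if a == 0 then None else Some a^-1) else Some 0.

(* [h * s] for a parameter [h] in C U {oo}, as an element of C(s) U {oo}. *)
Definition ext_param (R : realType) (h : option R[i]) : option (ratfun R) :=
  omap (fun c => ratC c * ratS R) h.

(* The continued fraction; [hh] is the sequence of the steps with a hat. The
   innermost denominator [h_k s] is read as [h_k s + 0]. *)
Definition fFD (R : realType) (k : nat) (hh h : 'I_k -> option R[i]) :
    option (ratfun R) :=
  foldr (fun i y =>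
           ext_inv (ext_add (ext_param (hh i))
                      (ext_inv (ext_add (ext_param (h i)) y))))
        (Some 0) (enum 'I_k).

(* The two Dirichlet-to-Neumann maps are matrices over C(s), or [None] when the
   defining formula divides by the zero rational function or involves an
   infinite matrix entry. *)

Definition dtnFE (R : realType) (n : nat) (l : 'I_n -> R[i]) :
    option 'M[ratfun R]_2 :=
  omap (fun c => c *: mx22 (coshFE l (ratS R)) (- 1) (- 1) (coshFE l (ratS R)))
       (ext_inv (Some (sinhFE l (ratS R)))).

Definition Zmx (R : realType) : 'M[R[i]]_2 :=
  (sqrtC 2%:R)^-1 *: mx22 1 (- 1) 1 1.

Definition dtnFD (R : realType) (k : nat) (hh h : 'I_k -> option R[i]) :
    option 'M[ratfun R]_2 :=
  match fFD hh h, ext_inv (fFD hh h) with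
  | Some a, Some b =>
      Some (map_mx (@ratC R) (Zmx R) *m mx22 a 0 0 b
              *m (map_mx (@ratC R) (Zmx R))^T)
  | _, _ => None
  end.

(* Main.v *)
Require Import Defs.
From HB Require Import structures.
From mathcomp Require Import all_boot all_order all_algebra.
From mathcomp Require Import reals complex.
From mathcomp Require Import ring.
Set Implicit Arguments.
Unset Strict Implicit.
Unset Printing Implicit Defensive.
Import GRing.Theory Num.Theory.
Local Open Scope ring_scope.

(** Write T = t(s) and T' = t(-s).  The hypothesis says that the entry a of the
    diagonal matrix in the finite-difference map is (T' - T) / (T' + T).
    Conjugating diag(a, 1/a) by the rotation Z by 45 degrees gives the matrix
    with diagonal entries (a + 1/a) / 2 and off-diagonal entries (a - 1/a) / 2.
    When a is the hyperbolic tangent of a half-angle, these are coth and - csch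
    of the full angle.  Since exp_FE(s) = T' / T and exp_FE(-s) = T / T', these
    half-angle formulas hold for the discrete functions as identities between
    rational expressions in T and T' ([coth_half], [csch_half]).

    The identities need T, T', T' + T and 2 to be nonzero in C(s); the first
    three are polynomials in s with values 1, 1 and 2 at s = 0
    ([tFE_poly]).  There remains the degenerate case a = 0, that is T = T':
    since T' + T is nonzero, sinh_FE(s) vanishes in exactly that case
    ([sinh_eq0]), and then neither map is defined. *)

Section HalfAngle.
Variables (K : fieldType) (t t' : K).
Hypotheses (nz2 : 2%:R != 0 :> K) (nzt : t != 0) (nzt' : t' != 0).
Hypothesis nzD : t' + t != 0.

Local Notation a := ((t' - t) / (t' + t)).
Local Notation sh := ((t' / t - t / t') / 2%:R).
Local Notation ch := ((t' / t + t / t') / 2%:R).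

Lemma sinh_factor : sh = (t' - t) * (t' + t) / (2%:R * t * t').
Proof. by field; rewrite nz2 nzt nzt'. Qed.

(** This matches the two ways in which the maps fail to be defined: sinh_FE(s)
    is inverted on one side, and f_k(s) on the other. *)
Lemma sinh_eq0 : (sh == 0) = (a == 0).
Proof.
by rewrite sinh_factor !(mulf_eq0, invr_eq0) (negPf nz2) (negPf nzt)
  (negPf nzt') (negPf nzD) !orbF.
Qed.

Hypothesis nza : a != 0.

Let nzB : t' - t != 0.
Proof. by apply: contraNneq nza => e; rewrite e mul0r. Qed.

Lemma coth_half : sh^-1 * ch = (a + a^-1) / 2%:R.
Proof. by rewrite sinh_factor; field; rewrite nz2 nzt nzt' nzD nzB. Qed.

Lemma csch_half : - sh^-1 = (a - a^-1) / 2%:R.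
Proof. by rewrite sinh_factor; field; rewrite nz2 nzt nzt' nzD nzB. Qed.

End HalfAngle.

Lemma eq_mx22 (K : pzRingType) (A : 'M[K]_2) (a b c d : K) :
  A 0 0 = a -> A 0 1 = b -> A 1 0 = c -> A 1 1 = d -> A = mx22 a b c d.
Proof.
have I2 (i : 'I_2) : i = 0 \/ i = 1.
  by case: i => [[|[|//]] ?]; [left | right]; apply: val_inj.
move=> e00 e01 e10 e11; apply/matrixP => i j; rewrite mxE.
by case: (I2 i) => ->; case: (I2 j) => ->.
Qed.

(** The factor z = 1 / sqrt 2 enters only through its square, so that no
    square root of 2 in C(s) has to be singled out. *)
Lemma conj_rot_diag (K : fieldType) (z a b : K) :
  let Z := z *: mx22 1 (- 1) 1 1 in
  Z *m mx22 a 0 0 b *m Z^T =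
  mx22 (z ^+ 2 * (a + b)) (z ^+ 2 * (a - b))
       (z ^+ 2 * (a - b)) (z ^+ 2 * (a + b)).
Proof.
by apply: eq_mx22; rewrite !(mxE, big_ord_recl, big_ord0) /=; ring.
Qed.

Section RatFun.
Variable R : realType.

Lemma natf_neq0 (n : nat) : (n.+1%:R : ratfun R) != 0.
Proof.
rewrite -(rmorph_nat (@tofrac _)) tofrac_eq0 -polyC_natr polyC_eq0.
by rewrite pnatr_eq0.
Qed.

Lemma ratCM (c d : R[i]) : ratC (c * d) = ratC c * ratC d.
Proof. by rewrite /ratC !rmorphM. Qed.

Lemma ratC_nat (n : nat) : ratC n%:R = n%:R :> ratfun R.
Proof. by rewrite /ratC !rmorph_nat. Qed.

Lemma ratC_natV (n : nat) : ratC n.+1%:R^-1 = n.+1%:R^-1 :> ratfun R.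
Proof.
apply: (mulIf (natf_neq0 n)); rewrite mulVf ?natf_neq0 //.
by rewrite -ratC_nat -ratCM mulVf ?(ratC_nat 1) // pnatr_eq0.
Qed.

Lemma ratC_invsqrt2 : ratC ((sqrtC 2%:R)^-1) ^+ 2 = 2%:R^-1 :> ratfun R.
Proof.
by rewrite expr2 -ratCM -expr2 exprVn sqrtCK ratC_natV.
Qed.

Lemma map_ratC_Zmx :
  map_mx (@ratC R) (Zmx R) = ratC ((sqrtC 2%:R)^-1) *: mx22 1 (- 1) 1 1.
Proof.
have -> : mx22 1 (- 1) 1 1 = map_mx (@ratC R) (mx22 1 (- 1) 1 1).
  by symmetry; apply: eq_mx22; rewrite !mxE /= /ratC ?rmorphN !rmorph1.
by apply/matrixP => i j; rewrite /Zmx !mxE ratCM.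
Qed.

(** The constant coefficient 1 keeps t(s), t(-s) and their sum away from 0 in
    C(s); stating it for any q without constant term covers both arguments
    s and - s. *)
Lemma tFE_poly n (l : 'I_n -> R[i]) (q : {poly R[i]}) : q.[0] = 0 ->
  exists2 p : {poly R[i]}, p.[0] = 1 & tFE l (tofrac q) = tofrac p.
Proof.
move=> q0; exists (\prod_(i < n) (1 - (l i / 2%:R)%:P * q)).
  rewrite horner_prod big1 // => i _.
  by rewrite !hornerE q0 mulr0 subr0.
rewrite /tFE rmorph_prod; apply: eq_bigr => i _.
rewrite /= tofracB tofrac1 tofracM -/(ratC (l i / 2%:R)) ratCM ratC_natV.
by rewrite mulrAC.
Qed.

Lemma tofrac_neq0_at (p : {poly R[i]}) (x : R[i]) :
  p.[x] != 0 -> tofrac p != 0.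
Proof. by rewrite tofrac_eq0; apply: contraNneq => ->; rewrite horner0. Qed.

Lemma tFE_neq0 n (l : 'I_n -> R[i]) :
  [/\ tFE l (ratS R) != 0, tFE l (- ratS R) != 0 &
      tFE l (- ratS R) + tFE l (ratS R) != 0].
Proof.
have [p p0 ->] := tFE_poly l (hornerX 0).
have [|p' p'0 e'] := @tFE_poly _ l (- 'X); first by rewrite !hornerE oppr0.
rewrite /ratS -rmorphN e' -rmorphD.
by split; apply: (@tofrac_neq0_at _ 0); rewrite ?hornerD ?p0 ?p'0 ?oner_eq0
  // -(natrD _ 1 1) pnatr_eq0.
Qed.

End RatFun.

Theorem proposition1 (R : realType) (k : nat) (l : 'I_(2 * k) -> R[i])
    (hh h : 'I_k -> option R[i]) :
  (1 <= k)%N ->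
  fFD hh h = Some (tanhFE_half l (ratS R)) ->
  dtnFE l = dtnFD hh h.
Proof.
move=> _ eq_f; have nz2 := natf_neq0 R 1.
have [nzt nzt' nzD] := tFE_neq0 l.
rewrite /dtnFD eq_f /dtnFE /ext_inv /sinhFE /coshFE /expFE /tanhFE_half opprK.
rewrite map_ratC_Zmx.
move: (tFE l (ratS R)) (tFE l (- ratS R)) nzt nzt' nzD => t t' nzt nzt' nzD.
rewrite (sinh_eq0 nz2 nzt nzt' nzD); case: eqVneq => [//|nza] /=.
rewrite conj_rot_diag ratC_invsqrt2 ![2%:R^-1 * _]mulrC.
rewrite -(coth_half nz2 nzt nzt' nzD nza) -(csch_half nz2 nzt nzt' nzD nza).
by congr Some; apply: eq_mx22; rewrite !mxE /= ?mulrN1.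
Qed.
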